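(* Consider the logistic regression case $\rho(t)=\log(1+e^t)$. Let $\{(\boldsymbol X_i,Y_i)\}_{i=1}^n$ be observed data and $\{(\boldsymbol X_i^*,Y_i^* )\}_{i=1}^M$ synthetic data with $\boldsymbol X_i,\boldsymbol X_i^*\in\mathbb R^p$ and $Y_i,Y_i^*\in\{0,1\}$, and let $\tau>0$. If the synthetic data are not separable in the sense that $$\max_{\boldsymbol e\in\mathbb R^p,\ \|\boldsymbol e\|=1}\ \min_{1\le i\le M}\ (2Y_i^*-1)\boldsymbol X_i^{*\top}\boldsymbol e<0,$$ and the $M\times p$ synthetic covariate matrix with rows $\boldsymbol X_i^{*\top}$ has full column rank, then the synthetic-data regularized estimator $$\widehat{\boldsymbol\beta}_M=\arg\max_{\boldsymbol\beta\in\mathbb R^p}\ \Big\{\sum_{i=1}^n\big[Y_i\boldsymbol X_i^\top\boldsymbol\beta-\rho(\boldsymbol X_i^\top\boldsymbol\beta)\big]+\frac{\tau}{M}\sum_{i=1}^M\big[Y_i^*\boldsymbol X_i^{*\top}\boldsymbol\beta-\rho(\boldsymbol X_i^{*\top}\boldsymbol\beta)\big]\Big\}$$ exists and is unique.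
   Context: $\|\cdot\|$ is the Euclidean norm. ''Exists'' means that the maximum over $\mathbb R^p$ is attained at a finite point. No assumption is made on the observed data or on the relation between $n$ and $p$. *)

(* Defs.v *)
From mathcomp Require Import all_boot all_order all_algebra.
From mathcomp Require Import classical_sets reals sequences exp.

Set Implicit Arguments.
Unset Strict Implicit.
Unset Printing Implicit Defensive.

Import Order.TTheory GRing.Theory Num.Theory.
Local Open Scope classical_set_scope.
Local Open Scope ring_scope.

Section Extrema.
Context {R : realType}.

(* Attained extrema, unlike [sup] and [inf]: [is_max A m] fails when [A] is
   empty or when its supremum does not belong to it. *)
Definition is_max (A : set R) (m : R) : Prop := A m /\ ubound A m.

Definition is_min (A : set R) (m : R) : Prop := A m /\ lbound A m.

Definition is_argmax (T : Type) (f : T -> R) (x : T) : Prop :=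
  forall y, f y <= f x.

End Extrema.

Section Logistic.
Context {R : realType} {p : nat}.

Definition dot (u v : 'cV[R]_p) : R := (u^T *m v) 0 0.

(* The norm that the library puts on matrices is the sup norm. *)
Definition enorm (u : 'cV[R]_p) : R := Num.sqrt (dot u u).

Definition rho (t : R) : R := ln (1 + expR t).

Definition loglik (n : nat) (X : 'I_n -> 'cV[R]_p) (Y : 'I_n -> bool)
    (b : 'cV[R]_p) : R :=
  \sum_(i < n) ((Y i)%:R * dot (X i) b - rho (dot (X i) b)).

Definition design (n : nat) (X : 'I_n -> 'cV[R]_p) : 'M[R]_(n, p) :=
  \matrix_(i < n) (X i)^T.

Definition objective (n M : nat) (tau : R)
    (X : 'I_n -> 'cV[R]_p) (Y : 'I_n -> bool)
    (Xs : 'I_M -> 'cV[R]_p) (Ys : 'I_M -> bool) (b : 'cV[R]_p) : R :=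
  loglik X Y b + tau / M%:R * loglik Xs Ys b.

(* The labels 0, 1 are recoded as -1, 1. *)
Definition signed_margin (n : nat) (X : 'I_n -> 'cV[R]_p) (Y : 'I_n -> bool)
    (e : 'cV[R]_p) (i : 'I_n) : R :=
  (2 * (Y i)%:R - 1) * dot (X i) e.

(* The max over the unit sphere of the min over the sample is negative. Both
   extrema exist as soon as [0 < p] and [0 < n]; otherwise the max-min is not
   defined and this does not hold. *)
Definition not_separable (n : nat) (X : 'I_n -> 'cV[R]_p) (Y : 'I_n -> bool) :
    Prop :=
  exists2 m : R,
    is_max [set v | exists2 e : 'cV[R]_p,
                      enorm e = 1 & is_min (range (signed_margin X Y e)) v] m
    & m < 0.

End Logistic.

(* Main.v *)
(** A log-likelihood term [y t - rho t] is concave, at most [0], and at most the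
    signed margin [(2 y - 1) t].  Non-separability, by homogeneity, gives some
    [m < 0] such that every [b] has a synthetic margin at most [m * enorm b]; so
    the objective is at most [tau / M * m * enorm b] and is coercive, and a
    maximizer exists by compactness.  It also shows that no nonzero direction is
    orthogonal to all synthetic covariates, so the synthetic log-likelihood is
    strictly concave and the maximizer is unique. *)
Require Import Defs.
From mathcomp Require Import all_boot all_order all_algebra.
From mathcomp Require Import ring lra.
From mathcomp Require Import boolp classical_sets set_interval reals topology.
From mathcomp Require Import function_spaces normedtype sequences derive exp.

Import Order.TTheory GRing.Theory Num.Theory.
Import numFieldNormedType.Exports.
Local Open Scope ring_scope.

Section Rho.
Context {R : realType}.
Implicit Types s t : R.

Lemma rho_ge0 t : 0 <= rho t.
Proof. by rewrite /rho ln_ge0// lerDl expR_ge0. Qed.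

Lemma rho_ge_id t : t <= rho t.
Proof.
rewrite -{1}(expRK t) /rho ler_ln ?posrE ?expR_gt0 ?addr_gt0 ?expR_gt0//.
by rewrite lerDr.
Qed.

Lemma continuous_rho : continuous (@rho R).
Proof.
move=> t; apply: (@continuous_comp _ _ _ (fun t => 1 + expR t) (@ln R)).
  by apply: continuousD; [exact: cst_continuous|exact: continuous_expR].
by apply: continuous_ln; rewrite addr_gt0 ?expR_gt0.
Qed.

(** With [x = expR (s / 2)] and [y = expR (t / 2)], exponentiating turns the claim into [(1 + x * y)
    ^+ 2 < (1 + x ^+ 2) * (1 + y ^+ 2)], and the two sides differ by [(x - y) ^+ 2]. *)
Lemma rho_midpoint_lt s t : s != t -> 2 * rho ((s + t) / 2) < rho s + rho t.
Proof.
move=> st.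
have dbl (u : R) : expR u = expR (u / 2) ^+ 2.
  by rewrite -expRM_natl; congr expR; field.
have mid : expR ((s + t) / 2) = expR (s / 2) * expR (t / 2).
  by rewrite -expRD; congr expR; field.
have xy : expR (s / 2) != expR (t / 2).
  by apply: contra st => /eqP/expR_inj st; apply/eqP; lra.
have pos (u : R) : 0 < 1 + expR u by rewrite addr_gt0 ?expR_gt0.
rewrite mulr_natl -lnXn// -lnM ?posrE// ltr_ln ?posrE ?exprn_gt0 ?mulr_gt0//.
rewrite mid (dbl s) (dbl t) -subr_gt0.
have -> : forall x y : R, (1 + x ^+ 2) * (1 + y ^+ 2) - (1 + x * y) ^+ 2 =
  (x - y) ^+ 2 by move=> *; ring.
by rewrite exprn_even_gt0//= subr_eq0.
Qed.

End Rho.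

Section LogLikelihood.
Context {R : realType}.

Definition llterm (y : bool) (t : R) : R := y%:R * t - rho t.

(** For label 1 this is [0 <= rho t], for label 0 it is [t <= rho t]. *)
Lemma llterm_le_margin y t : llterm y t <= (2 * y%:R - 1) * t.
Proof.
by rewrite /llterm; have := rho_ge0 t; have := rho_ge_id t; case: y => /=; lra.
Qed.

Lemma llterm_le0 y t : llterm y t <= 0.
Proof.
by rewrite /llterm; have := rho_ge0 t; have := rho_ge_id t; case: y => /=; lra.
Qed.

Lemma llterm_midpoint_lt y s t :
  s != t -> llterm y s + llterm y t < 2 * llterm y ((s + t) / 2).
Proof. by move=> /rho_midpoint_lt; rewrite /llterm; lra. Qed.

Lemma llterm_midpoint_le y s t :
  llterm y s + llterm y t <= 2 * llterm y ((s + t) / 2).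
Proof.
have [->|/llterm_midpoint_lt/ltW//] := eqVneq s t.
have -> : (t + t) / 2 = t by field.
by lra.
Qed.

Lemma continuous_llterm y : continuous (llterm y).
Proof.
move=> t; apply: continuousB; last exact: continuous_rho.
by apply: continuousM; [exact: cst_continuous|exact: cvg_id].
Qed.

Context {p : nat}.
Implicit Types u b : 'cV[R]_p.

Lemma dotE u b : dot u b = \sum_j u j 0 * b j 0.
Proof. by rewrite /dot mxE; apply: eq_bigr => j _; rewrite mxE. Qed.

Lemma dotDr u b c : dot u (b + c) = dot u b + dot u c.
Proof. by rewrite /dot mulmxDr mxE. Qed.

Lemma dotZr u k b : dot u (k *: b) = k * dot u b.
Proof. by rewrite /dot -scalemxAr mxE. Qed.

Lemma dotZl u k b : dot (k *: u) b = k * dot u b.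
Proof. by rewrite /dot linearZ/= -scalemxAl mxE. Qed.

Lemma dot_midpoint u b c : dot u (2^-1 *: (b + c)) = (dot u b + dot u c) / 2.
Proof. by rewrite dotZr dotDr mulrC. Qed.

Lemma sqr_coord_le_dot b j : b j 0 ^+ 2 <= dot b b.
Proof.
by rewrite dotE (bigD1 j)//= expr2 lerDl sumr_ge0// => i _; rewrite -expr2 sqr_ge0.
Qed.

Lemma dot_ge0 b : 0 <= dot b b.
Proof. by rewrite dotE sumr_ge0// => i _; rewrite -expr2 sqr_ge0. Qed.

Lemma coord_le_enorm b j : `|b j 0| <= enorm b.
Proof. by rewrite -sqrtr_sqr /enorm ler_wsqrtr// sqr_coord_le_dot. Qed.

Lemma enorm_gt0 b : b != 0 -> 0 < enorm b.
Proof.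
apply: contraNT; rewrite -leNgt => b0; apply/eqP/colP => j; rewrite mxE; apply/eqP.
by rewrite -normr_le0 (le_trans (coord_le_enorm b j)).
Qed.

Lemma enorm_normalize b : b != 0 -> enorm ((enorm b)^-1 *: b) = 1.
Proof.
move=> /enorm_gt0 b0.
rewrite {1}/enorm dotZl dotZr -(sqr_sqrtr (dot_ge0 b)) -/(enorm b).
by rewrite expr2 mulKf ?gt_eqF// mulVf ?gt_eqF// sqrtr1.
Qed.

Context {n : nat} (X : 'I_n -> 'cV[R]_p) (Y : 'I_n -> bool).

Lemma loglik_le0 b : loglik X Y b <= 0.
Proof. by apply: sumr_le0 => i _; exact: llterm_le0. Qed.

Lemma loglik_le_margin b i : loglik X Y b <= signed_margin X Y b i.
Proof.
rewrite /loglik (bigD1 i)//= -[leRHS]addr0 lerD ?llterm_le_margin//.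
by apply: sumr_le0 => k _; exact: llterm_le0.
Qed.

Lemma loglik_midpoint_le b c :
  loglik X Y b + loglik X Y c <= 2 * loglik X Y (2^-1 *: (b + c)).
Proof.
rewrite /loglik -big_split mulr_sumr ler_sum//= => i _.
by rewrite dot_midpoint llterm_midpoint_le.
Qed.

Lemma loglik_midpoint_lt b c i : dot (X i) b != dot (X i) c ->
  loglik X Y b + loglik X Y c < 2 * loglik X Y (2^-1 *: (b + c)).
Proof.
move=> neq; rewrite /loglik -big_split mulr_sumr/= (bigD1 i)//=.
rewrite [ltRHS](bigD1 i)//= ltr_leD//.
  by rewrite dot_midpoint llterm_midpoint_lt.
by rewrite ler_sum// => k _; rewrite dot_midpoint llterm_midpoint_le.
Qed.

(** Phrased on row vectors to match the extreme value theorem [EVT_max_rV]. *)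
Lemma continuous_loglik_tr : continuous (fun v : 'rV[R]_p => loglik X Y v^T).
Proof.
apply: continuous_big => [|i _]; first exact: add_continuous.
move=> v; apply: (@continuous_comp _ _ _ (fun v : 'rV[R]_p => dot (X i) v^T)
  (llterm (Y i))); last exact: continuous_llterm.
have -> : (fun v : 'rV[R]_p => dot (X i) v^T) =
    (fun v => \sum_j X i j 0 * v 0 j).
  by apply/funext => w; rewrite dotE; apply: eq_bigr => j _; rewrite mxE.
apply: continuous_big => [|j _]; first exact: add_continuous.
move=> w; apply: continuousM; [exact: cst_continuous|exact: coord_continuous].
Qed.

Lemma not_separable_margin : not_separable X Y -> exists2 m, m < 0 &
  forall b, b != 0 -> exists i, signed_margin X Y b i <= m * enorm b.
Proof.
(* The index [i0], where the minimum for [e0] is attained, shows that the sample is nonempty, so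
   [arg min] below makes sense. *)
case=> m [[e0 _ [[i0 _ _] _]] ubm] m0; exists m => // b b0.
set e := (enorm b)^-1 *: b.
pose i := [arg min_(k < i0) signed_margin X Y e k]%O.
exists i.
have : signed_margin X Y e i <= m.
  apply: ubm; exists e; first exact: enorm_normalize.
  split; first by exists i.
  move=> _ [k _ <-]; rewrite /i; case: arg_minP => // l _; exact.
(* The margin is linear in the direction, so the bound on the unit vector [e] scales back to [b]. *)
rewrite /signed_margin /e dotZr mulrCA mulrC.
by rewrite ler_pdivrMr// enorm_gt0.
Qed.

End LogLikelihood.

(** Outside a large enough box [f] stays below [f 0], so its maximum over the box, which is compact
    and contains 0, is global. *)
Lemma coercive_argmax (R : realType) (p : nat) (f : 'cV[R]_p -> R) (c : R) :
    continuous (fun v : 'rV[R]_p => f v^T) -> 0 < c ->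
    (forall b, f b <= - c * enorm b) ->
  exists b, is_argmax f b.
Proof.
move=> cf c0 fle.
(* The radius solves [- c * r = f 0]. *)
pose r := - f 0 / c.
have r0 : 0 <= r.
  apply: divr_ge0; last exact: ltW.
  rewrite oppr_ge0 (le_trans (fle _))//.
  by rewrite mulNr oppr_le0 mulr_ge0 ?sqrtr_ge0// ltW.
pose K := [set v : 'rV[R]_p | forall j, `[- r, r]%classic (v ord0 j)]%classic.
have K0 : K 0 by move=> j; rewrite mxE /= in_itv/= oppr_le0 r0.
have [|||v Kv vmax] := @EVT_max_rV R p (fun v => f v^T) K.
- by exists 0.
- by apply: (@rV_compact R _ (fun=> `[- r, r]%classic)) => j; exact: segment_compact.
- exact: continuous_subspaceT.
exists v^T => b.
have [Kb|] := pselect (K b^T).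
  by have := vmax b^T; rewrite trmxK; apply; rewrite inE.
(* Outside the box some coordinate exceeds [r] in absolute value, hence so does [enorm b]. *)
move=> /existsNP[j]; rewrite /= in_itv/= mxE -ler_norml.
move=> /negP; rewrite -ltNge => rb.
have f0 : f 0 <= f v^T by have := vmax 0; rewrite trmx0; apply; rewrite inE.
apply: le_trans f0; apply: le_trans (fle b) _.
rewrite mulNr lerNl mulrC -ler_pdivrMr// -/r.
by rewrite ltW// (lt_le_trans rb)// coord_le_enorm.
Qed.

Theorem theorem1 (R : realType) (n M p : nat) (tau : R)
    (X : 'I_n -> 'cV[R]_p) (Y : 'I_n -> bool)
    (Xs : 'I_M -> 'cV[R]_p) (Ys : 'I_M -> bool)
    (htau : 0 < tau)
    (hsep : not_separable Xs Ys)
    (hrank : \rank (design Xs) = p) :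
  exists! b : 'cV[R]_p, is_argmax (objective tau X Y Xs Ys) b.
Proof.
have [m m0 hm] := not_separable_margin _ _ hsep.
have M0 : 0 < tau / M%:R.
  (* An attained minimum provides an index in ['I_M], whence [0 < M]. *)
  case: hsep => ? [[e _ [[i _ _] _]] _] _.
  by rewrite divr_gt0// ltr0n (leq_ltn_trans _ (ltn_ord i)).
have [b bmax] : exists b, is_argmax (objective tau X Y Xs Ys) b.
  apply: (@coercive_argmax _ _ _ (- m * (tau / M%:R))).
  - rewrite /objective => v.
    apply: (@continuousD _ _ _ (fun v : 'rV[R]_p => loglik X Y v^T)
      (fun v => tau / M%:R * loglik Xs Ys v^T)).
      exact: continuous_loglik_tr.
    by apply: continuousM; [exact: cst_continuous|exact: continuous_loglik_tr].
  - by rewrite mulr_gt0// oppr_gt0.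
  - move=> b; rewrite [- m * _]mulNr opprK /objective.
    rewrite -[leRHS]add0r lerD ?loglik_le0//.
    rewrite [m * _]mulrC -[leRHS]mulrA ler_pM2l//.
    (* The margin bound [hm] covers only nonzero [b]; at 0 the bound to prove is 0. *)
    have [->|/hm[i]] := eqVneq b 0; last exact/le_trans/loglik_le_margin.
    suff -> : enorm (0 : 'cV[R]_p) = 0 by rewrite mulr0 loglik_le0.
    by rewrite /enorm /dot mulmx0 mxE sqrtr0.
exists b; split=> // c cmax.
(* Two distinct maximizers [b] and [c] are refuted by their midpoint, where the objective would be
   strictly larger. *)
apply/eqP; apply: contraT => bc.
have [i] : exists i, signed_margin Xs Ys (b - c) i <= m * enorm (b - c).
  by apply: hm; rewrite subr_eq0.
have : m * enorm (b - c) < 0 by rewrite nmulr_rlt0// enorm_gt0 ?subr_eq0.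
move=> /[swap] /le_lt_trans /[apply] neg.
(* Equal predictors would make the margin of [b - c] at [i] zero, but it is negative. *)
have neq : dot (Xs i) b != dot (Xs i) c.
  apply: contraTneq neg => eqd; rewrite /signed_margin dotDr -[- c]scaleN1r dotZr eqd.
  by rewrite mulN1r subrr mulr0 ltxx.
have := loglik_midpoint_lt _ Ys _ _ _ neq; rewrite -(ltr_pM2l M0) => lts.
have := loglik_midpoint_le X Y b c.
move: lts (bmax (2^-1 *: (b + c))) (cmax (2^-1 *: (b + c))).
by rewrite /objective mulrDr !mulrA ![_ * 2]mulrC -!mulrA; lra.
Qed.
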